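(* Let $R$ be a commutative ring with identity, $S\subseteq R$ a multiplicative set, and $J$ an ideal of $R$. Then $R$ is $S$-$J$-Noetherian if and only if every prime ideal $P$ of $R$ that is a $J$-ideal and satisfies $P\cap S=\emptyset$ is $S$-finite.
   Context: A multiplicative set $S\subseteq R$ is a subset containing $1$ and closed under multiplication. An ideal $I$ of $R$ is called $S$-finite if there exist $s\in S$ and a finitely generated ideal $F$ of $R$ such that $sI\subseteq F\subseteq I$. An ideal $I$ of $R$ is called a $J$-ideal if $I\nsubseteq J$. The ring $R$ is called $S$-$J$-Noetherian if every $J$-ideal of $R$ is $S$-finite. *)

(* Defs.v *)
From mathcomp Require Import all_boot all_algebra.
From mathcomp Require Import boolp classical_sets cardinality.

Set Implicit Arguments.
Unset Strict Implicit.
Unset Printing Implicit Defensive.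

Import GRing.Theory.

Local Open Scope classical_set_scope.
Local Open Scope ring_scope.

(* [R : comPzRingType] allows the zero ring.  Ideals are [set]s satisfying
   [is_ideal] because [ring_quotient.idealr] covers only decidable proper
   ideals of nonzero rings, whereas here the whole ring is an ideal. *)

Definition is_multiplicative (R : comPzRingType) (S : set R) : Prop :=
  S 1 /\ forall s t, S s -> S t -> S (s * t).

Definition is_ideal (R : comPzRingType) (I : set R) : Prop :=
  [/\ I 0,
      forall x y, I x -> I y -> I (x + y)
    & forall a x, I x -> I (a * x)].

Definition is_prime_ideal (R : comPzRingType) (P : set R) : Prop :=
  [/\ is_ideal P,
      P <> [set: R]
    & forall a b, P (a * b) -> P a \/ P b].

Definition ideal_gen (R : comPzRingType) (A : set R) : set R :=
  smallest (@is_ideal R) A.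

Definition is_fg_ideal (R : comPzRingType) (F : set R) : Prop :=
  exists2 A : set R, finite_set A & F = ideal_gen A.

Definition S_finite (R : comPzRingType) (S I : set R) : Prop :=
  exists s F, [/\ S s, is_fg_ideal F, [set s * x | x in I] `<=` F & F `<=` I].

Definition is_J_ideal (R : comPzRingType) (J I : set R) : Prop :=
  is_ideal I /\ ~ (I `<=` J).

Definition S_J_Noetherian (R : comPzRingType) (S J : set R) : Prop :=
  forall I : set R, is_J_ideal J I -> S_finite S I.

(* Main.v *)
Require Import Defs.
From mathcomp Require Import all_boot all_algebra.
From mathcomp Require Import boolp classical_sets cardinality.

(** This is the analogue of Cohen's theorem that a ring is Noetherian as soon
    as its prime ideals are finitely generated.  Only the if part
    has content.  If some J-ideal fails to be S-finite, the J-ideals that are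
    not S-finite satisfy Zorn's condition ([bigcup_not_S_finite]): an S-finite
    union of a chain would make the member of the chain that contains its
    finitely many generators S-finite.  Let P be a maximal one.

    P is disjoint from S, since an element s of P in S gives s P in (s) in P
    and makes P S-finite.  In particular 1 is not in P.

    P is prime: suppose a b is in P while a and b are not.  The ideals P + (a)
    and (P : a) contain P, hence are J-ideals; they contain a and b
    respectively, hence are strictly larger than P, and so they are S-finite
    by maximality.  But S-finiteness of P + (a) and of (P : a) implies that of
    P ([S_finite_adjoin_colon]), a contradiction.

    So P is a prime J-ideal disjoint from S that is not S-finite, against the
    hypothesis. *)

Import GRing.Theory.

Local Open Scope classical_set_scope.
Local Open Scope ring_scope.

(** * Zorn's lemma and chains of sets *)

(** Requiring a bound for nonempty chains only allows predicates that fail for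
    the empty set.  It follows from the version for all chains, applied to the
    sets whose union with [I] satisfies [P]. *)
Lemma Zorn_bigcup_nonempty (T : Type) (P : set (set T)) (I : set T) :
  P I ->
  (forall C : set (set T), C `<=` P -> C !=set0 -> total_on C subset ->
     P (\bigcup_(X in C) X)) ->
  exists M, P M /\ forall B, M `<` B -> ~ P B.
Proof.
move=> PI chainP.
have [|A [PA maxA]] := @Zorn_bigcup T [set A | P (A `|` I)].
  move=> C CP totC /=.
  have [->|C0] := eqVneq C set0; first by rewrite bigcup_set0 set0U.
  have {}C0 : C !=set0 by apply/set0P.
  rewrite -bigcupUl // -(bigcup_image C (setU^~ I) id).
  apply: chainP => [_ [X CX <-]||_ _ [X CX <-] [Y CY <-]]; first exact: CP.
    by case: C0 => X CX; exists (X `|` I), X.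
  by case: (totC X Y CX CY) => sub; [left|right]; exact: setSU.
exists (A `|` I); split=> // B [AIB BAI] PB.
apply: (maxA B); first split.
- by move=> x Ax; apply: AIB; left.
- by move=> BA; apply: BAI => x /BA Ax; left.
by rewrite /= setUidl // => x Ix; apply: AIB; right.
Qed.

Lemma finite_sub_chain (T : eqType) (C : set (set T)) (A : set T) :
  C !=set0 -> total_on C subset -> finite_set A ->
  A `<=` \bigcup_(X in C) X -> exists2 X, C X & A `<=` X.
Proof.
move=> [X0 CX0] totC /finite_seqP[s ->]; elim: s => [|x s IHs] sub.
  by exists X0.
have [|X CX sX] := IHs.
  by move=> y /= ys; apply: sub; rewrite /= inE ys orbT.
have [Y CY Yx] : (\bigcup_(X in C) X) x by apply: sub; rewrite /= inE eqxx.
have [XY|YX] := totC X Y CX CY.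
- exists Y => // y /=; rewrite inE => /orP[/eqP->//|ys].
  by apply: XY; apply: sX.
- exists X => // y /=; rewrite inE => /orP[/eqP->|ys]; first exact: YX.
  exact: sX.
Qed.

(** * Ideals *)

Definition adjoin {R : comPzRingType} (P : set R) (a : R) : set R :=
  [set p + a * r | p in P & r in [set: R]].

Definition colon {R : comPzRingType} (P : set R) (a : R) : set R :=
  [set x | P (a * x)].

Section IdealTheory.
Context {R : comPzRingType}.
Implicit Types (A B C I P : set R) (a x : R).

Lemma ideal_gen_ideal A : is_ideal (ideal_gen A).
Proof.
split=> [I [[]]//|x y Ax Ay I AI|a x Ax I AI].
- by case: (AI) => -[_ addI _] _; apply: addI; [exact: Ax|exact: Ay].
- by case: (AI) => -[_ _ mulI] _; apply: mulI; exact: Ax.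
Qed.

Lemma ideal_gen_min I A : is_ideal I -> A `<=` I -> ideal_gen A `<=` I.
Proof. by move=> idI AI; apply: smallest_sub. Qed.

Lemma sub_ideal_gen A : A `<=` ideal_gen A.
Proof. exact: sub_gen_smallest. Qed.

Lemma ideal_genS A B : A `<=` B -> ideal_gen A `<=` ideal_gen B.
Proof. by apply: sub_smallest2r; exact: ideal_gen_ideal. Qed.

Lemma idealB I x y : is_ideal I -> I x -> I y -> I (x - y).
Proof.
by move=> [_ addI mulI] Ix Iy; apply: addI => //; rewrite -mulN1r; exact: mulI.
Qed.

Lemma adjoin_ideal P a : is_ideal P -> is_ideal (adjoin P a).
Proof.
move=> [P0 addP mulP]; split.
- by exists 0 => //; exists 0 => //; rewrite mulr0 addr0.
- move=> _ _ [p Pp [r _ <-]] [q Pq [t _ <-]].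
  exists (p + q); first exact: addP.
  by exists (r + t) => //; rewrite mulrDr addrACA.
- move=> c _ [p Pp [r _ <-]]; exists (c * p); first exact: mulP.
  by exists (c * r) => //; rewrite mulrDr mulrCA.
Qed.

Lemma sub_adjoin P a : P `<=` adjoin P a.
Proof. by move=> x Px; exists x => //; exists 0 => //; rewrite mulr0 addr0. Qed.

Lemma mem_adjoin P a : is_ideal P -> adjoin P a a.
Proof. by move=> [P0 _ _]; exists 0 => //; exists 1 => //; rewrite mulr1 add0r. Qed.

Lemma colon_ideal P a : is_ideal P -> is_ideal (colon P a).
Proof.
move=> [P0 addP mulP]; split; rewrite /colon /=.
- by rewrite mulr0.
- by move=> x y Px Py; rewrite mulrDr; exact: addP.
- by move=> c x Px; rewrite mulrCA; exact: mulP.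
Qed.

Lemma sub_colon P a : is_ideal P -> P `<=` colon P a.
Proof. by move=> [_ _ mulP] x Px; exact: mulP. Qed.

(** Each generator is [p + a * r] with [p] in [P]; the finitely many [p]
    chosen this way generate, together with [a], all the given generators. *)
Lemma adjoin_fg_sub P A a :
  finite_set A -> A `<=` adjoin P a ->
  exists B, [/\ finite_set B, B `<=` P &
    ideal_gen A `<=` adjoin (ideal_gen B) a].
Proof.
move=> finA sub.
have /choice[f fP] x : exists p, A x -> P p /\ exists r, p + a * r = x.
  have [/sub[p Pp [r _ prx]]|nAx] := pselect (A x); last by exists 0.
  by exists p => _; split=> //; exists r.
exists [set f x | x in A]; split; first exact: finite_image.
  by move=> _ [x Ax <-]; case: (fP x Ax).
apply: ideal_gen_min; first by apply: adjoin_ideal; exact: ideal_gen_ideal.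
move=> x Ax; have [_ [r fxr]] := fP x Ax.
by exists (f x); [apply: sub_ideal_gen; exists x|exists r].
Qed.

End IdealTheory.

(** * S-finiteness *)

Section SFinite.
Context {R : comPzRingType} (S : set R).
Implicit Types (I P : set R) (a : R).

Lemma S_finiteP I : is_ideal I ->
  S_finite S I <-> exists s A, [/\ S s, finite_set A, A `<=` I &
    forall x, I x -> ideal_gen A (s * x)].
Proof.
move=> idI; split=> [[s [_ [Ss [A finA ->] sI AI]]]|[s [A [Ss finA AI sI]]]].
- exists s, A; split=> // [x Ax|x Ix]; first by apply: AI; exact: sub_ideal_gen.
  by apply: sI; exists x.
- exists s, (ideal_gen A); split=> //; first by exists A.
  + by move=> _ [x Ix <-]; exact: sI.
  + exact: ideal_gen_min.
Qed.

Lemma S_finite_meet I : is_ideal I -> I `&` S !=set0 -> S_finite S I.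
Proof.
move=> idI [s [Is Ss]]; apply/S_finiteP => //; exists s, [set s].
split=> // [_ ->//|x _].
have [_ _ mul_s] := ideal_gen_ideal [set s].
by rewrite mulrC; apply: mul_s; apply: sub_ideal_gen.
Qed.

(** For [x] in [P], a multiple [s * x] is [p + a * r] with [p] in an ideal
    generated by finitely many elements [A] of [P].  Then [a * r] is in [P],
    so [r] is in [(P : a)] and a multiple [t * r] lies in the ideal generated
    by finitely many elements [B] of [(P : a)].  Hence [t * s * x] lies in the
    ideal generated by [A] and [a B], which are subsets of [P]. *)
Lemma S_finite_adjoin_colon P a :
  (forall s t, S s -> S t -> S (s * t)) -> is_ideal P ->
  S_finite S (adjoin P a) -> S_finite S (colon P a) -> S_finite S P.
Proof.
move=> mulS idP.
move=> /(S_finiteP _ (adjoin_ideal P a idP))[s [A0 [Ss finA0 A0P sP]]].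
move=> /(S_finiteP _ (colon_ideal P a idP))[t [B [St finB BP tP]]].
have [A [finA AP genA]] := adjoin_fg_sub P A0 a finA0 A0P.
apply/S_finiteP => //; exists (t * s), (A `|` [set a * b | b in B]).
have idG := ideal_gen_ideal (A `|` [set a * b | b in B]).
split; first exact: mulS.
- by rewrite finite_setU; split=> //; exact: finite_image.
- by move=> _ [/AP//|[b Bb <-]]; exact: BP.
move=> x Px.
have [p Ap [r _ prE]] : adjoin (ideal_gen A) a (s * x).
  by apply: genA; apply: sP; exact: sub_adjoin.
have Pr : colon P a r.
  rewrite /colon /= (_ : a * r = s * x - p); last by rewrite -prE addrC addKr.
  apply: idealB => //; first by case: idP => _ _; apply.
  exact: (ideal_gen_min P A idP AP).
have Gtr : ideal_gen (A `|` [set a * b | b in B]) (a * (t * r)).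
  (* The elements that [a] multiplies into an ideal form an ideal. *)
  apply: (ideal_gen_min _ _ (colon_ideal _ a idG) _ _ (tP r Pr)) => b Bb.
  by apply: sub_ideal_gen; right; exists b.
case: idG => _ addG mulG.
rewrite -mulrA -prE mulrDr (mulrCA t); apply: addG => //; apply: mulG.
by apply: ideal_genS Ap => y Ay; left.
Qed.

(** A union of a chain that is S-finite has its generators in one member,
    which is then S-finite with the same multiplier and generators. *)
Lemma bigcup_not_S_finite (J : set R) (C : set (set R)) :
  C `<=` [set I | is_J_ideal J I /\ ~ S_finite S I] ->
  C !=set0 -> total_on C subset ->
  is_J_ideal J (\bigcup_(X in C) X) /\ ~ S_finite S (\bigcup_(X in C) X).
Proof.
move=> CP C0 totC.
have idC X : C X -> is_ideal X by move=> /CP[[]].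
have idU : is_ideal (\bigcup_(X in C) X).
  split.
  - by case: C0 => X CX; exists X => //; case: (idC X CX).
  - move=> x y [X CX Xx] [Y CY Yy].
    have [XY|YX] := totC X Y CX CY.
    + by exists Y => //; case: (idC Y CY) => _ addY _; apply: addY => //; exact: XY.
    + by exists X => //; case: (idC X CX) => _ addX _; apply: addX => //; exact: YX.
  - by move=> a x [X CX Xx]; exists X => //; case: (idC X CX) => _ _; apply.
split.
  split=> // UJ; case: C0 => X CX; have [[_ XJ] _] := CP X CX.
  by apply: XJ => x Xx; apply: UJ; exists X.
move=> /(S_finiteP _ idU)[s [A [Ss finA AU sU]]].
have [X CX AX] := finite_sub_chain _ C A C0 totC finA AU.
have [_] := CP X CX; apply; apply/S_finiteP; first exact: idC.
by exists s, A; split=> // x Xx; apply: sU; exists X.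
Qed.

End SFinite.

Lemma J_ideal_sub {R : comPzRingType} (J I I' : set R) :
  is_J_ideal J I -> is_ideal I' -> I `<=` I' -> is_J_ideal J I'.
Proof.
by move=> [_ IJ] idI' II'; split=> // I'J; apply: IJ => x /II'; exact: I'J.
Qed.

Lemma maximal_not_S_finite_prime {R : comPzRingType} (S J P : set R) :
  is_multiplicative S -> is_J_ideal J P -> ~ S_finite S P ->
  (forall I, P `<` I -> is_J_ideal J I -> S_finite S I) ->
  is_prime_ideal P /\ P `&` S = set0.
Proof.
move=> [S1 mulS] JP nfP maxP; have [idP _] := JP.
have PS : P `&` S = set0.
  apply/eqP; apply: contrapT => /negP/set0P PS.
  by apply: nfP; exact: S_finite_meet.
split=> //; split=> // [PT|a b Pab].
  suff : (P `&` S) 1 by rewrite PS.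
  by rewrite PT.
apply: contrapT => /not_orP[nPa nPb]; apply: nfP.
apply: (S_finite_adjoin_colon S P a mulS idP); apply: maxP.
- by split; [exact: sub_adjoin|move=> /(_ a (mem_adjoin P a idP))].
- by apply: J_ideal_sub JP _ _; [exact: adjoin_ideal|exact: sub_adjoin].
- by split; [exact: sub_colon|move=> /(_ b Pab)].
- by apply: J_ideal_sub JP _ _; [exact: colon_ideal|exact: sub_colon].
Qed.

Theorem theorem2p3 (R : comPzRingType) (S J : set R)
    (hS : is_multiplicative S) (hJ : is_ideal J) :
  S_J_Noetherian S J <->
  (forall P : set R,
     is_prime_ideal P -> is_J_ideal J P -> P `&` S = set0 -> S_finite S P).
Proof.
split=> [noeth P _ JP _|primeS I JI]; first exact: noeth.
apply: contrapT => nfI.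
have [|P [[JP nfP] maxP]] := Zorn_bigcup_nonempty R
    [set I | is_J_ideal J I /\ ~ S_finite S I] I (conj JI nfI).
  exact: bigcup_not_S_finite.
have [|primeP PS] := maximal_not_S_finite_prime S J P hS JP nfP.
  by move=> B PB JB; apply: contrapT => nfB; exact: (maxP B PB).
exact: nfP (primeS P primeP JP PS).
Qed.
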